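(* For any integers $n\ge1$ and $w>2$, there exists an odd positive integer $t$ for which a non-degenerate $LSSD(16^n t,k,\lambda;w)$ exists, for some $k,\lambda$.
   Context: A symmetric $(v,k,\lambda)$-design consists of a set of $v$ points and a collection of $v$ blocks such that every block contains $k$ points, every point lies in $k$ blocks, every pair of distinct points lies in exactly $\lambda$ common blocks, and every pair of distinct blocks meets in exactly $\lambda$ points. Its incidence graph is the bipartite graph on points and blocks with a point adjacent to a block iff the point is in the block. A linked system of symmetric designs $LSSD(v,k,\lambda;w)$, $w\ge 2$, is a graph $\Gamma$ on $wv$ vertices whose vertex set is partitioned into $w$ sets (''fibers'') $X_1,\dots,X_w$ of size $v$ such that: (i) no edge has both ends in the same fiber; (ii) for all $i\ne j$, the subgraph of $\Gamma$ induced between $X_i$ and $X_j$ is the incidence graph of some symmetric $(v,k,\lambda)$-design; (iii) there are constants $\mu,\nu$ such that for all distinct $h,i,j$ and all $a\in X_i$, $b\in X_j$, the number of common neighbours of $a$ and $b$ lying in $X_h$ is $\mu$ if $a\sim b$ and $\nu$ if $a\not\sim b$. It is non-degenerate if $1<k<v-1$. *)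

(* Defs.v *)
From HB Require Import structures.
From mathcomp Require Import all_boot.

Set Implicit Arguments.
Unset Strict Implicit.
Unset Printing Implicit Defensive.

(* A block is an element [b] of [blocks] and [inc p b] says that [p] lies in
   [b].  The incidence relation represents the incidence graph: restricting the
   adjacency relation of a graph to two disjoint vertex sets gives one. *)
Record symmetric_design (P B : finType) (points : {set P}) (blocks : {set B})
    (inc : P -> B -> bool) (v k lambda : nat) : Prop := SymmetricDesign {
  design_card_points : #|points| = v;
  design_card_blocks : #|blocks| = v;
  design_block_size : forall b, b \in blocks ->
    #|[set p in points | inc p b]| = k;
  design_point_degree : forall p, p \in points ->
    #|[set b in blocks | inc p b]| = k;
  design_points_meet : forall p q, p \in points -> q \in points -> p != q ->
    #|[set b in blocks | inc p b && inc q b]| = lambda;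
  design_blocks_meet : forall b c, b \in blocks -> c \in blocks -> b != c ->
    #|[set p in points | inc p b && inc p c]| = lambda
}.

Record is_LSSD (T : finType) (adj : rel T) (fibers : {set {set T}})
    (v k lambda w : nat) : Prop := IsLSSD {
  lssd_w_ge2 : 2 <= w;
  lssd_adj_sym : symmetric adj;
  lssd_adj_irrefl : irreflexive adj;
  lssd_card : #|T| = w * v;
  lssd_partition : partition fibers [set: T];
  lssd_card_fibers : #|fibers| = w;
  lssd_card_fiber : forall X, X \in fibers -> #|X| = v;
  lssd_no_edge_in_fiber : forall X, X \in fibers ->
    forall a b, a \in X -> b \in X -> ~~ adj a b;
  lssd_design : forall X Y, X \in fibers -> Y \in fibers -> X != Y ->
    symmetric_design X Y adj v k lambda;
  lssd_common_neighbours : exists mu nu : nat,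
    forall H X Y, H \in fibers -> X \in fibers -> Y \in fibers ->
      H != X -> H != Y -> X != Y ->
    forall a b, a \in X -> b \in Y ->
      #|[set c in H | adj a c && adj b c]| = if adj a b then mu else nu
}.

Definition LSSD_exists (v k lambda w : nat) : Prop :=
  exists (T : finType) (adj : rel T) (fibers : {set {set T}}),
    is_LSSD adj fibers v k lambda w.

Definition nondegenerate (v k : nat) : bool := 1 < k < v - 1.

(* Main.v *)
Require Import Defs.
From HB Require Import structures.
From mathcomp Require Import all_boot.
From mathcomp Require Import ssralg ssrnum ssrint rat matrix zmodp.
From mathcomp Require Import cyclic finalg finfield ring zify.

Set Implicit Arguments.
Unset Strict Implicit.
Unset Printing Implicit Defensive.

Import GRing.Theory Num.Theory.

(** Take a Hadamard matrix [H] of order [s] with a column of ones, and an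
    orthogonal array of strength 2 over an alphabet of size [s] with [w + 1]
    coordinates, that is, [s ^ 2] points and [w + 1] parallel classes of [s]
    lines, lines of different classes meeting in one point. Discard one class
    and use it to number the points of every remaining line. A row of [H]
    written along a line of class [i] is a vector supported on that line; the
    [s ^ 2] vectors obtained from class [i] are orthogonal, and two vectors
    from different classes have inner product 1 or -1, since their supports
    share a single point. So the [w] classes give [w] mutually unbiased real
    bases of a space of dimension [s ^ 2]. Writing [M_ij] for the sign matrix
    of inner products between classes [i] and [j], unbiasedness reads [M_ih
    M_hj = s M_ij] and [M_ih M_hi = s ^ 2 I]; since the column of ones is
    attached to the points of one line of the discarded class, all row sums of
    [M_ij] equal [s]. Counting common [+1] entries turns these identities into
    the axioms of a linked system of symmetric designs on [v = s ^ 2] points,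
    two vectors being adjacent when their inner product is 1 ([linked_LSSD]).

    It remains to find, for given [n] and [w], an order [s = 4 ^ n * r] with
    [r] odd having both ingredients; then [v = 16 ^ n * r ^ 2].

    Hadamard matrices: since [3 ^ (2 N + 1)] is 3 modulo 8, the Paley matrix
    over the field with that many elements has order 4 times an odd number,
    and doubling [2 (n - 1)] times gives [s = 4 ^ n * r] ([paley_hadamard],
    [sylvester_double]). Here [N] is arbitrary, so [s] is as large as desired.

    Orthogonal arrays: the 2-part of [s] may be as small as 4, so products of
    arrays over finite fields, which have about as many coordinates as the
    least prime power factor of [s], do not suffice. However, every large even
    [s] has an array with many coordinates ([has_OA_large_even]). Wilson's
    construction ([wilson_orthogonal_array]) produces an array of order [m * t
    + u] from arrays of orders [t], [m], [m + 1] and [u <= t]. Arrays of order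
    coprime to [K`!] with [K] coordinates are given by lines over the integers
    modulo that order. When [m + 1] is a power of 2, for which a finite field
    exists, and [m] is coprime to [K`!], the Chinese remainder theorem
    provides [t] in the interval [s / (m + 1) <= t <= s / m] such that [t] and
    [s - m * t] are coprime to [K`!]. *)

(** * Orthogonal arrays *)

(** The words are the points of a net, and the letter at coordinate [i] is the
    line of class [i] through the point. Words are compared pointwise and
    given by a [Prop], so that neither the words nor the alphabet need be
    counted. *)
Definition orthogonal_array (I S : Type) (words : (I -> S) -> Prop) : Prop :=
  (forall i j, i <> j -> forall a b, exists2 x, words x & x i = a /\ x j = b) /\
  (forall i j, i <> j -> forall x y, words x -> words y ->
     x i = y i -> x j = y j -> x =1 y).

Definition has_OA (I : Type) (s : nat) : Prop :=
  exists words : (I -> 'I_s) -> Prop, orthogonal_array words.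

Lemma eq_card_bijection (S S' : finType) :
  #|S| = #|S'| -> exists f : S -> S', bijective f.
Proof.
move=> eqS; exists (fun x => enum_val (cast_ord eqS (enum_rank x))).
exists (fun y => enum_val (cast_ord (esym eqS) (enum_rank y))) => x;
  by rewrite enum_valK ?cast_ordK ?cast_ordKV enum_rankK.
Qed.

Lemma orthogonal_array_bij (I S S' : Type) (words : (I -> S) -> Prop)
    (f : S -> S') :
  bijective f -> orthogonal_array words ->
  orthogonal_array (fun y => exists2 x, words x & y =1 f \o x).
Proof.
move=> [g fK gK] [exW uniW]; split=> i j Dij => [a b|y y'].
  have [x Wx [xi xj]] := exW i j Dij (g a) (g b).
  by exists (f \o x); [exists x | rewrite /= xi xj !gK].
move=> [x Wx eqy] [x' Wx' eqy']; rewrite !eqy !eqy' /=.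
move=> /(can_inj fK) eqi /(can_inj fK) eqj k.
by rewrite eqy eqy' /= (uniW i j Dij x x').
Qed.

Lemma has_OA_of_card (I : Type) (S : finType) (words : (I -> S) -> Prop) s :
  #|S| = s -> orthogonal_array words -> has_OA I s.
Proof.
move=> cardS OA; have [|f bijf] := @eq_card_bijection S 'I_s.
  by rewrite card_ord.
by eexists; apply: orthogonal_array_bij bijf OA.
Qed.

Lemma OA_on_card (I : Type) (S : finType) s :
  #|S| = s -> has_OA I s ->
  exists words : (I -> S) -> Prop, orthogonal_array words.
Proof.
move=> cardS [words OA]; have [|f bijf] := @eq_card_bijection 'I_s S.
  by rewrite card_ord.
by eexists; apply: orthogonal_array_bij bijf OA.
Qed.

(** The words are the affine functions evaluated at the points [c i]: a line
    is recovered from two of its values as soon as the difference of the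
    abscissas is invertible. *)
Lemma linear_orthogonal_array (I : Type) (R : comUnitRingType) (c : I -> R) :
  (forall i j, i <> j -> (c i - c j)%R \is a GRing.unit) ->
  orthogonal_array
    (fun x : I -> R => exists p q : R, x =1 (fun i => p + c i * q)%R).
Proof.
move=> unitc; split=> i j Dij => [a b|x y [p [q eqx]] [p' [q' eqy]]].
  pose q := ((a - b) / (c i - c j))%R; pose p := (a - c i * q)%R.
  exists (fun k => p + c k * q)%R; first by exists p, q.
  split; first by rewrite subrK.
  have -> : (p + c j * q = a - (c i - c j) * q)%R by rewrite /p; ring.
  by rewrite mulrC divrK ?unitc // subKr.
rewrite !eqx !eqy => eqi eqj k; rewrite eqx eqy.
have eqq : q = q'.
  apply: (mulrI (unitc i j Dij)).
  have -> : ((c i - c j) * q = (p + c i * q) - (p + c j * q))%R by ring.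
  by rewrite eqi eqj; ring.
by move: eqi; rewrite eqq => /addIr ->.
Qed.

(** The integers below [K] have differences that divide [K`!] up to sign,
    hence invertible ones modulo [m]. *)
Lemma has_OA_of_coprime (I : finType) K m :
  #|I| <= K -> 1 < m -> coprime m K`! -> has_OA I m.
Proof.
move=> leIK m_gt1 com.
pose c (i : I) : 'Z_m := (enum_rank i)%:R%R.
apply: (@has_OA_of_card I 'Z_m _ m _ (@linear_orthogonal_array I _ c _)).
  by rewrite card_ord Zp_cast.
have unit_lt (a b : 'I_#|I|) : b < a -> (a%:R - b%:R : 'Z_m)%R \is a GRing.unit.
  move=> ltba; rewrite -natrB 1?ltnW // unitZpE //.
  apply: coprime_dvdr com; apply: dvdn_fact.
  by rewrite subn_gt0 ltba (leq_trans (leq_subr _ _)) // (leq_trans _ leIK) // ltnW.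
move=> i j /eqP; rewrite /c -(inj_eq (@enum_rank_inj I)) -(inj_eq val_inj) neq_ltn.
by case/orP=> lt_ij; [rewrite -opprB unitrN|]; apply: unit_lt.
Qed.

(** The constant word, the one left out in Wilson's construction, is the
    affine function of slope 0. *)
Lemma field_orthogonal_array (I : finType) (F : finFieldType) (a : F) :
  #|I| <= #|F| ->
  exists2 words : (I -> F) -> Prop,
    orthogonal_array words & words (fun=> a).
Proof.
move=> leIF; pose c (i : I) : F := enum_val (widen_ord leIF (enum_rank i)).
eexists; first apply: (@linear_orthogonal_array I F c).
  move=> i j Dij; rewrite unitfE subr_eq0; apply/eqP=> /enum_val_inj /(congr1 val).
  by move=> eqr; apply: Dij; apply: enum_rank_inj; apply: val_inj.
by exists a, 0%R => i; rewrite mulr0 addr0.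
Qed.

(** * The construction of Wilson *)

Section Wilson.

Variables (I T M U : Type) (io : U -> T).
Variables (master : (option I -> T) -> Prop) (onM : (I -> M) -> Prop).
Variables (onM1 : (I -> option M) -> Prop) (onU : (I -> U) -> Prop).

(** The [m * t + u] letters are [t] groups of [m] letters and [u] extra
    letters, the latter identified through [io] with some letters of the extra
    coordinate [None] of the master array. Each master word selects one group
    in each coordinate. If its extra letter is not of the form [io u], the
    selected groups are filled with the array on [M]. If it is [io u], the new
    letter [u] is adjoined to each selected group, and the groups are filled
    with the array on [option M], [None] standing for [u]; the word constantly
    equal to [u] is left out, because it would arise from every master word
    with that extra letter. The last constructor restores the words all of
    whose letters are extra. *)
Inductive wilson_words : (I -> T * M + U) -> Prop :=
| WilsonOutside x c w of master x & (forall u, x None <> io u) & onM c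
    & w =1 (fun i => inl (x (Some i), c i)) : wilson_words w
| WilsonInside x u d w of master x & x None = io u & onM1 d
    & (exists i, d i <> None)
    & w =1 (fun i => if d i is Some a then inl (x (Some i), a) else inr u)
    : wilson_words w
| WilsonHole e w of onU e & w =1 (fun i => inr (e i)) : wilson_words w.

Hypothesis io_inj : injective io.
Hypothesis io_dec : forall y, (exists u, y = io u) \/ (forall u, y <> io u).
Hypotheses (OAmaster : orthogonal_array master) (OAM : orthogonal_array onM).
Hypotheses (OAM1 : orthogonal_array onM1) (OAU : orthogonal_array onU).
Hypothesis const_onM1 : onM1 (fun=> None).

(** Two prescribed letters in ordinary groups determine the master word by its
    coordinates [i] and [j]; an ordinary letter and an extra one determine it
    by an ordinary coordinate and the coordinate [None]; two extra letters can
    only come from the array on [U], since a filling word with [None] in two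
    coordinates is the excluded constant word. *)
Lemma wilson_orthogonal_array : orthogonal_array wilson_words.
Proof.
have SomeI (i j : I) : i <> j -> Some i <> Some j by move=> Dij [].
have inside_not_const i j d : i <> j -> onM1 d -> (exists k, d k <> None) ->
    d i = None -> d j = None -> False.
  move=> Dij Wd [k dk] di dj; apply: dk.
  by rewrite (OAM1.2 i j Dij d (fun=> None)).
split=> i j Dij.
  have Dji : j <> i by move/esym.
  case=> [[a c]|u] [[b c']|u'].
  - have [x Wx [xi xj]] := OAmaster.1 _ _ (SomeI _ _ Dij) a b.
    have [[u xu]|xu] := io_dec (x None).
      have [d Wd [di dj]] := OAM1.1 i j Dij (Some c) (Some c').
      exists (fun k => if d k is Some a then inl (x (Some k), a) else inr u).
        by apply: WilsonInside Wx xu Wd _ _ => //; exists i; rewrite di.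
      by rewrite di dj xi xj.
    have [d Wd [di dj]] := OAM.1 i j Dij c c'.
    exists (fun k => inl (x (Some k), d k)); last by rewrite di dj xi xj.
    exact: WilsonOutside Wx xu Wd _.
  - have [//|x Wx [xi xn]] := OAmaster.1 (Some i) None _ a (io u').
    have [d Wd [di dj]] := OAM1.1 i j Dij (Some c) None.
    exists (fun k => if d k is Some a then inl (x (Some k), a) else inr u').
      by apply: WilsonInside Wx xn Wd _ _ => //; exists i; rewrite di.
    by rewrite di dj xi.
  - have [//|x Wx [xj xn]] := OAmaster.1 (Some j) None _ b (io u).
    have [d Wd [di dj]] := OAM1.1 i j Dij None (Some c').
    exists (fun k => if d k is Some a then inl (x (Some k), a) else inr u).
      by apply: WilsonInside Wx xn Wd _ _ => //; exists j; rewrite dj.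
    by rewrite di dj xj.
  have [e We [ei ej]] := OAU.1 i j Dij u u'.
  by exists (fun k => inr (e k)); [apply: WilsonHole We _ | rewrite ei ej].
have DSij := SomeI _ _ Dij.
have DSN k : Some k <> None :> option I by [].
move=> w w' Ww Ww';
  case: Ww => [x c {}w Wx xN Wc|x u d {}w Wx xu Wd Nd|e {}w We] eqw;
  case: Ww' => [x' c' {}w' Wx' xN' Wc'|x' u' d' {}w' Wx' xu' Wd' Nd'
    |e' {}w' We'] eqw';
  rewrite !eqw !eqw' //.
- move=> [xi ci] [xj cj] k; rewrite eqw eqw'.
  by rewrite (OAmaster.2 _ _ DSij x x') // (OAM.2 _ _ Dij c c').
- case: (d' i) => // a' [xi _]; case: (d' j) => // b' [xj _].
  by case: (xN u'); rewrite (OAmaster.2 _ _ DSij x x').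
- case: (d i) => // a [xi _]; case: (d j) => // b [xj _].
  by case: (xN' u); rewrite -(OAmaster.2 _ _ DSij x x').
- move=> eqi eqj k; rewrite eqw eqw'.
  suffices [eqx eqd] : x =1 x' /\ d =1 d'.
    have -> : u = u' by apply: io_inj; rewrite -xu eqx.
    by rewrite eqx eqd.
  move: eqi eqj.
  case di: (d i) => [a|]; case di': (d' i) => [a'|] //;
  case dj: (d j) => [b|]; case dj': (d' j) => [b'|] //; last first.
  + by case: (inside_not_const i j d Dij).
  + move=> [equ] [xj eqb]; split.
      by apply: OAmaster.2 (DSN j) _ _ Wx Wx' xj _; rewrite xu xu' equ.
    by apply: (OAM1.2 _ _ Dij); rewrite // ?di ?di' ?dj ?dj' ?eqb.
  + move=> [xi eqa] [equ]; split.
      by apply: OAmaster.2 (DSN i) _ _ Wx Wx' xi _; rewrite xu xu' equ.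
    by apply: (OAM1.2 _ _ Dij); rewrite // ?di ?di' ?dj ?dj' ?eqa.
  + move=> [xi eqa] [xj eqb]; split; first exact: OAmaster.2 DSij _ _ Wx Wx' xi xj.
    by apply: (OAM1.2 _ _ Dij); rewrite // ?di ?di' ?dj ?dj' ?eqa ?eqb.
- case di: (d i) => [a|] // _; case dj: (d j) => [b|] // _.
  by case: (inside_not_const i j d Dij).
- case di': (d' i) => [a|] // _; case dj': (d' j) => [b|] // _.
  by case: (inside_not_const i j d' Dij).
move=> [ei] [ej] k; rewrite eqw eqw'.
by rewrite (OAU.2 _ _ Dij e e').
Qed.

End Wilson.

Lemma has_OA_wilson (I : finType) (F : finFieldType) m t u :
  #|F| = m.+1 -> #|I| <= #|F| -> u <= t ->
  has_OA (option I) t -> has_OA I m -> has_OA I u -> has_OA I (m * t + u).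
Proof.
move=> cardF leIF leut [master OAmaster] [onM OAM] [onU OAU].
have [|f bijf] := @eq_card_bijection F (option 'I_m).
  by rewrite card_option card_ord.
have [g fK gK] := bijf.
have [onF OAF constF] := field_orthogonal_array (g None) leIF.
have OAM1 := orthogonal_array_bij bijf OAF.
have const1 : exists2 x, onF x & (fun=> None) =1 f \o x.
  by exists (fun=> g None) => // i; rewrite /= gK.
pose io (a : 'I_u) := widen_ord leut a.
have io_inj : injective io by move=> a b [eqab]; apply: val_inj.
have io_dec (y : 'I_t) : (exists a, y = io a) \/ (forall a, y <> io a).
  have [ltyu|leuy] := ltnP y u; [left | right].
    by exists (Ordinal ltyu); apply: val_inj.
  by move=> a ya; move: leuy; rewrite ya leqNgt /= ltn_ord.
apply: (has_OA_of_card _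
  (wilson_orthogonal_array io_inj io_dec OAmaster OAM OAM1 OAU const1)).
by rewrite card_sum card_prod !card_ord mulnC.
Qed.

(** * Orthogonal arrays of every large even order *)

Lemma coprime_no_prime x P :
  0 < P -> (forall r, prime r -> r %| P -> r %| x -> False) -> coprime x P.
Proof.
move=> P_gt0 nor; rewrite /coprime eqn_leq gcdn_gt0 P_gt0 orbT andbT leqNgt.
apply/negP=> g_gt1; apply: (nor (pdiv (gcdn x P))).
- exact: pdiv_prime.
- exact: dvdn_trans (pdiv_dvd _) (dvdn_gcdr _ _).
- exact: dvdn_trans (pdiv_dvd _) (dvdn_gcdl _ _).
Qed.

(** Euler's theorem gives exponents [e], as large as desired, with [2 ^ e]
    congruent to 2 modulo the odd part [Q] of [K`!]. *)
Lemma exists_mersenne K :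
  exists e, [/\ 0 < e, K < 2 ^ e, coprime (2 ^ e).-1 K`!
    & forall r, prime r -> odd r -> r %| K`! -> (2 ^ e).-1 = 1 %[mod r]].
Proof.
pose Q := K`!`_(2^'); pose e := (K * totient Q).+1.
have Q_gt0 : 0 < Q by rewrite part_gt0.
have modQ : (2 ^ e).-1 = 1 %[mod Q].
  suffices : 2 ^ e = 2 %[mod Q].
    have -> : 2 ^ e = 1 + (2 ^ e).-1 by rewrite add1n prednK ?expn_gt0.
    by move/eqP; rewrite (eqn_modDl 1 _ 1) => /eqP.
  have co2Q : coprime 2 Q by rewrite coprime2n odd_2'nat part_pnat.
  rewrite expnS mulnC expnM expnAC -modnMml -modnXm (Euler_exp_totient co2Q).
  by rewrite modnXm exp1n modnMml.
have modr r : prime r -> odd r -> r %| K`! -> (2 ^ e).-1 = 1 %[mod r].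
  move=> r_pr r_odd r_K.
  have rQ : r %| Q.
    have : r \in \pi(Q).
      rewrite pi_of_part ?fact_gt0 // !inE mem_primes r_pr fact_gt0 r_K.
      by apply: contraL r_odd => /eqP ->.
    by rewrite mem_primes => /and3P[].
  by rewrite -(modn_dvdm _ rQ) modQ modn_dvdm.
exists e; split=> //.
  apply: leq_ltn_trans (ltn_expl _ (ltnSn 1)); apply: leqW.
  by rewrite leq_pmulr // totient_gt0.
apply: coprime_no_prime => [|r r_pr r_K r_m]; first exact: fact_gt0.
have [r_odd|r_even] := boolP (odd r).
  by move: (modr r r_pr r_odd r_K); rewrite (eqP r_m) modn_small // prime_gt1.
have [r2|] := even_prime r_pr; last by rewrite (negPf r_even).
have : ~~ odd (2 ^ e) by rewrite oddX.
rewrite -(prednK (_ : 0 < 2 ^ e)) ?expn_gt0 // oddS negbK.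
by move: r_m; rewrite r2 dvdn2 => /negbTE ->.
Qed.

(** Modulo a prime [r] dividing [K`!], the choice [t = 1] works if [r] divides
    [s], since then [s - m * t] is [- m]. Otherwise [r] is odd, as [s] is
    even, so [m] is 1, and the choice [t = 2 * s] works since then [s - m * t]
    is [- s]. The lower bound on [s] makes the interval of the admissible [t]
    longer than [K`!], so that it meets the required residue class. *)
Lemma wilson_decomposition K m s :
  odd m -> coprime m K`! ->
  (forall r, prime r -> odd r -> r %| K`! -> m = 1 %[mod r]) ->
  ~~ odd s -> m.+1 * (m * K`! + 2) <= s ->
  exists t u, [/\ s = m * t + u, 1 < u <= t, coprime t K`! & coprime u K`!].
Proof.
move=> m_odd com mod1 s_even s_big; set P := K`! in com mod1 s_big *.
have P_gt0 : 0 < P by apply: fact_gt0.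
have s_gt0 : 0 < s by apply: leq_trans s_big; rewrite muln_gt0 addn_gt0 orbT.
pose t1 := chinese P`_\pi(s) P`_(\pi(s)^') 1 (2 * s).
have coP : coprime P`_\pi(s) P`_(\pi(s)^') by apply: coprime_partC.
(* [c] is a lower bound that ensures [s <= m.+1 * t]; the correction below [P]
   moves it to the residue class of [t1], as [P.-1] is [-1] modulo [P]. *)
pose c := (s %/ m.+1).+1; pose t := c + (t1 + P.-1 * c) %% P.
have modt : t = t1 %[mod P].
  rewrite /t modnDmr addnCA -mulSn prednK //.
  by rewrite -modnDmr modnMr addn0.
have t_lt : t < c + P by rewrite ltn_add2l ltn_mod.
have c_le : c <= t by rewrite leq_addr.
have s_div := divn_eq s m.+1; have s_mod : s %% m.+1 < m.+1 by rewrite ltn_mod.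
have d_big : m * P + 2 <= s %/ m.+1 by rewrite leq_divRL // mulnC.
pose u := s - m * t.
have [mt_lt u_le] : m * t + 1 < s /\ u <= t.
  have le_mt : m * t <= s %/ m.+1 * m + m * P.
    by rewrite (mulnC _ m) -mulnDr leq_mul2l -ltnS t_lt orbT.
  have ge_mt : (s %/ m.+1).+1 * m.+1 <= m * t + t.
    by rewrite addnC -mulSn mulnC leq_mul2l c_le orbT.
  rewrite /u leq_subLR; rewrite mulnS in s_div; rewrite mulSn mulnS in ge_mt.
  move: s_div s_mod d_big le_mt ge_mt; clear.
  move: (m * t) (m * P) (s %/ m.+1 * m) (s %/ m.+1) (s %% m.+1) => *; lia.
have eqs : s = m * t + u by rewrite subnKC //; lia.
have rmodt r : prime r -> r %| P ->
    if r %| s then t = 1 %[mod r] else t = 2 * s %[mod r].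
  move=> r_pr rP; rewrite -(modn_dvdm _ rP) modt modn_dvdm //.
  case: ifP => rs.
    have rP' : r %| P`_\pi(s).
      have : r \in \pi(P`_\pi(s)).
        by rewrite pi_of_part // !inE !mem_primes r_pr P_gt0 rP s_gt0 rs.
      by rewrite mem_primes => /and3P[].
    by rewrite -(modn_dvdm _ rP') chinese_modl // modn_dvdm.
  have rP' : r %| P`_(\pi(s)^').
    have : r \in \pi(P`_(\pi(s)^')).
      by rewrite pi_of_part // !inE !mem_primes r_pr P_gt0 rP s_gt0 rs.
    by rewrite mem_primes => /and3P[].
  by rewrite -(modn_dvdm _ rP') chinese_modr // modn_dvdm.
have not_rm r : prime r -> r %| P -> ~~ (r %| m).
  move=> r_pr rP; apply: contraL com => rm.
  apply/negP=> /eqP com1; have : r %| gcdn m P by rewrite dvdn_gcd rm.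
  by rewrite com1 dvdn1 => /eqP r1; rewrite r1 in r_pr.
have not_rt r : prime r -> r %| P -> ~~ (r %| t).
  move=> r_pr rP; have := rmodt r r_pr rP; case: ifP => rs modtr.
    by rewrite /dvdn modtr modn_small ?prime_gt1.
  rewrite /dvdn modtr -/(dvdn r _) Euclid_dvdM // rs orbF dvdn_prime2 //.
  by apply: contraFN rs => /eqP ->; rewrite dvdn2.
exists t, u; split=> //.
- by rewrite u_le andbT /u; lia.
- by apply: coprime_no_prime => // r r_pr rP; apply/negP/not_rt.
apply: coprime_no_prime => // r r_pr rP ru.
have := rmodt r r_pr rP; case: ifP => rs modtr.
  move: rs; rewrite {1}eqs dvdn_addl // Euclid_dvdM //.
  by rewrite (negPf (not_rm _ _ _)) // (negPf (not_rt _ _ _)).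
have r_odd : odd r.
  by have [r2|//] := even_prime r_pr; move: rs; rewrite r2 dvdn2 s_even.
have : s = 2 * s %[mod r].
  rewrite {1}eqs -modnDmr (eqP ru) addn0 -modnMml mod1 // modnMml mul1n.
  exact: modtr.
move/eqP; rewrite mul2n -addnn -{1}[s]addn0 eqn_modDl eq_sym mod0n.
by rewrite -/(dvdn r s) rs.
Qed.

(** The master array has one more coordinate than [I], which is why [#|I|] has
    to stay strictly below [K]. *)
Lemma has_OA_large_even K :
  1 < K ->
  exists N, forall s, ~~ odd s -> N <= s ->
    forall I : finType, #|I| < K -> has_OA I s.
Proof.
move=> K_gt1; have [e [e_gt0 Ke com mod1]] := exists_mersenne K.
set m := (2 ^ e).-1 in com mod1.
have m1 : 2 ^ e = m.+1 by rewrite prednK ?expn_gt0.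
have m_odd : odd m by rewrite -[odd m]negbK -oddS -m1 oddX; case: (e) e_gt0.
exists (m.+1 * (m * K`! + 2)) => s s_even s_big I ltIK.
have [t [u [-> /andP[u_gt1 leut] cot cou]]] :=
  wilson_decomposition m_odd com mod1 s_even s_big.
have [F _ cardF] := @pPrimePowerField 2 e isT e_gt0.
have leIK := ltnW ltIK.
apply: (@has_OA_wilson I F).
- by rewrite cardF m1.
- by rewrite cardF (leq_trans leIK) // ltnW.
- exact: leut.
- apply: has_OA_of_coprime cot; rewrite ?card_option //.
  exact: leq_trans u_gt1 leut.
- apply: has_OA_of_coprime com => //.
  by rewrite -ltnS -m1; apply: leq_ltn_trans Ke.
exact: has_OA_of_coprime cou.
Qed.

(** * Hadamard matrices *)

Local Open Scope ring_scope.

Record normalized_hadamard (S : finType) (H : S -> S -> int) (c0 : S) : Prop :=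
  NormalizedHadamard {
    hadamard_sqr : forall x y, H x y * H x y = 1;
    hadamard_col0 : forall x, H x c0 = 1;
    hadamard_rows : forall x x',
      \sum_y H x y * H x' y = #|S|%:R *+ (x == x');
    hadamard_cols : forall y y',
      \sum_x H x y * H x y' = #|S|%:R *+ (y == y')
  }.

(** For the square matrix [A] with these entries, [A A^T] is scalar and
    invertible over the rationals, so the inverse of [A] is a multiple of
    [A^T], and [A^T A] is the same scalar matrix. *)
Lemma rows_to_cols (S : finType) (H : S -> S -> int) :
  (forall x x', \sum_y H x y * H x' y = #|S|%:R *+ (x == x')) ->
  (forall y y', \sum_x H x y * H x y' = #|S|%:R *+ (y == y')).
Proof.
move=> rows y y'; have S_gt0 : (0 < #|S|)%N by apply/card_gt0P; exists y.
pose A : 'M[rat]_#|S| := \matrix_(i, j) (H (enum_val i) (enum_val j))%:~R.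
have AAt : A *m A^T = #|S|%:R%:M.
  apply/matrixP=> i k; rewrite !mxE.
  under eq_bigr => j _ do rewrite !mxE -intrM.
  rewrite -rmorph_sum /= -(inj_eq enum_val_inj).
  rewrite -(big_enum_val (fun z => H (enum_val i) z * H (enum_val k) z))  /=.
  by rewrite rows rmorphMn rmorph_nat.
have S_neq0 : (#|S|%:R : rat) != 0 by rewrite pnatr_eq0 -lt0n.
have AtA : A^T *m A = #|S|%:R%:M.
  have /mulmx1C : A *m (#|S|%:R^-1 *: A^T) = 1%:M.
    by rewrite -scalemxAr AAt scale_scalar_mx mulVf.
  rewrite -scalemxAl => /(congr1 ( *:%R #|S|%:R)).
  by rewrite scalerA mulfV // scale1r scale_scalar_mx mulr1.
apply: (@intr_inj rat); move/matrixP/(_ (enum_rank y) (enum_rank y')): AtA.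
rewrite !mxE (inj_eq (@enum_rank_inj S)).
under eq_bigr => j _ do rewrite !mxE -intrM !enum_rankK.
rewrite -rmorph_sum /= -(big_enum_val (fun z => H z y * H z y')) /=.
by move=> ->; rewrite rmorphMn rmorph_nat.
Qed.

Lemma sum_option (T : finType) (G : option T -> int) :
  \sum_y G y = G None + \sum_a G (Some a).
Proof.
rewrite (bigD1 None) //=; congr (_ + _).
rewrite (reindex_omap Some id) //=; last by case.
by apply: eq_bigl => a; rewrite eqxx.
Qed.

Section QuadraticCharacter.

Variable F : finFieldType.
Implicit Types x y d : F.
Hypothesis cardF : (#|F| %% 4 = 3)%N.

Let h := #|F|.-1./2.

(** The quadratic character, through Euler's criterion. *)
Definition qchar (x : F) : int :=
  if x == 0 then 0 else if x ^+ h == 1 then 1 else -1.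

Let cardE : #|F| = (h.*2).+1.
Proof. by rewrite /h; lia. Qed.

Let h_odd : odd h.
Proof. by rewrite /h; lia. Qed.

Lemma pow_half_card x : x != 0 -> (x ^+ h == 1) || (x ^+ h == -1).
Proof.
move=> x_neq0; rewrite -eqf_sqr expr1n -exprM muln2.
by apply/eqP; apply: (mulfI x_neq0); rewrite mulr1 -exprS -cardE expf_card.
Qed.

(** If -1 were 1, the translation by 1 would show that [#|F|] vanishes in [F],
    whereas [#|F|] is odd. *)
Lemma neqN1_1 : (-1 : F) != 1.
Proof.
apply/eqP=> eqN1; have two0 : (2%:R : F) = 0 by rewrite mulr2n -{1}eqN1 addNr.
have : #|F|%:R = 0 :> F.
  have : \sum_(x : F) x = \sum_(x : F) (x + 1).
    by rewrite {1}(reindex_inj (addIr 1)).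
  by rewrite big_split /= sumr_const -{1}[\sum_x x]addr0 => /addrI <-.
by rewrite cardE -addn1 natrD -mul2n natrM two0 mul0r add0r => /eqP;
  rewrite oner_eq0.
Qed.

Lemma qchar_sqr x : qchar x * qchar x = (x != 0)%:R.
Proof. by rewrite /qchar; case: (x == 0) => //=; case: ifP. Qed.

Lemma qcharM x y : qchar (x * y) = qchar x * qchar y.
Proof.
rewrite /qchar mulf_eq0; case: eqP => [|/eqP x_neq0]; first by rewrite mul0r.
case: eqP => [|/eqP y_neq0]; first by rewrite mulr0.
rewrite /= exprMn.
have /orP[/eqP->|/eqP->] := pow_half_card x_neq0;
have /orP[/eqP->|/eqP->] := pow_half_card y_neq0;
by rewrite ?mulN1r ?opprK ?mul1r ?eqxx ?(negPf neqN1_1).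
Qed.

Lemma qcharN x : qchar (- x) = - qchar x.
Proof.
rewrite -mulN1r qcharM /qchar oppr_eq0 oner_eq0 -signr_odd h_odd expr1.
by rewrite (negPf neqN1_1) mulN1r.
Qed.

(** As [#|F|] is 3 modulo 4, the character is odd, so the values at [x] and [-
    x] cancel. *)
Lemma sum_qchar : \sum_x qchar x = 0.
Proof.
have : \sum_x qchar x = - \sum_x qchar x.
  rewrite {1}(reindex_inj (@oppr_inj F)) /= -sumrN.
  by apply: eq_bigr => x _; rewrite qcharN.
by move=> eqN; lia.
Qed.

(** For nonzero [x] the summand is [qchar (1 + d / x)], whose argument takes
    every value except 1. Since [0^-1 = 0], the map [x |-> 1 + d / x] is a
    bijection of [F] that sends 0 to 1, and only that term has to be
    subtracted. *)
Lemma sum_qcharMD d : d != 0 -> \sum_x qchar x * qchar (x + d) = -1.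
Proof.
move=> d_neq0; have qchar0 : qchar 0 = 0 by rewrite /qchar eqxx.
have qchar1 : qchar 1 = 1 by rewrite /qchar oner_eq0 expr1n eqxx.
have step x : qchar x * qchar (x + d) =
    (if x == 0 then 0 else qchar (1 + d / x)).
  have [->|x_neq0] := eqVneq x 0; first by rewrite qchar0 mul0r.
  have -> : x + d = x * (1 + d / x) by rewrite mulrDr mulr1 mulrCA mulfV ?mulr1.
  by rewrite qcharM mulrA qchar_sqr x_neq0 mul1r.
rewrite (eq_bigr _ (fun x _ => step x)).
have -> : \sum_x (if x == 0 then 0 else qchar (1 + d / x)) =
   \sum_x (qchar (1 + d / x) - (x == 0)%:R).
  apply: eq_bigr => x _; case: eqP => [->|_]; last by rewrite subr0.
  by rewrite invr0 mulr0 addr0 qchar1 subrr.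
rewrite sumrB (bigD1 0 (F := fun x => (x == 0)%:R)) //= eqxx.
rewrite [X in _ - (_ + X)]big1 ?addr0; last by move=> x /negPf->.
have inj : injective (fun x => 1 + d / x).
  by move=> x y /addrI /(mulfI d_neq0) /invr_inj.
by rewrite -(reindex_inj inj (F := qchar) (P := xpredT)) sum_qchar sub0r.
Qed.

(** Paley's matrix of the first type, with the rows indexed by [F] negated in
    order to make the column [None] constant. *)
Definition paley_matrix (x y : option F) : int :=
  match x, y with
  | Some a, Some b => qchar (b - a) - (a == b)%:R
  | _, _ => 1
  end.

Lemma paley_sqr u v : paley_matrix u v * paley_matrix u v = 1.
Proof.
case: u v => [a|] [b|] //=; have := qchar_sqr (b - a); rewrite subr_eq0.
by rewrite /qchar subr_eq0 (eq_sym b); case: eqP => //= _; rewrite subr0.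
Qed.

Lemma sum_indicator a (g : F -> int) : \sum_b (a == b)%:R * g b = g a.
Proof.
rewrite (bigD1 a) //= eqxx mul1r big1 ?addr0 // => b /negPf.
by rewrite eq_sym => ->; rewrite mul0r.
Qed.

Lemma sum_paley_row a : \sum_b paley_matrix (Some a) (Some b) = -1.
Proof.
rewrite sumrB (reindex_inj (addIr a)) /=.
under eq_bigr => b _ do rewrite addrK.
rewrite sum_qchar sub0r; congr (- _).
by under eq_bigr => b _ do rewrite -[_%:R]mulr1; rewrite sum_indicator.
Qed.

(** For distinct [a] and [a'] in [F], the character sum contributes -1, which
    the column [None] compensates, and the two diagonal terms cancel because
    the character is odd. *)
Lemma paley_rows u v : \sum_w paley_matrix u w * paley_matrix v w =
  #|{: option F}|%:R *+ (u == v).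
Proof.
have [<-|] := eqVneq u v.
  by under eq_bigr => w _ do rewrite paley_sqr; rewrite sumr_const mulr1n.
rewrite sum_option mulr0n.
case: u v => [a|] [a'|] //= => [Daa'|_|_]; last first.
- under eq_bigr => b _ do rewrite mul1r.
  by rewrite (sum_paley_row a').
- under eq_bigr => b _ do rewrite mulr1.
  by rewrite (sum_paley_row a).
have {}Daa' : a != a' by apply: contraNneq Daa' => ->.
under eq_bigr => b _ do rewrite mulrBl !mulrBr.
rewrite !sumrB.
have -> : \sum_b qchar (b - a) * qchar (b - a') = -1.
  rewrite (reindex_inj (addIr a)) /=.
  under eq_bigr => b _ do rewrite addrK -addrA.
  by rewrite sum_qcharMD // subr_eq0.
have -> : \sum_b qchar (b - a) * (a' == b)%:R = qchar (a' - a).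
  by under eq_bigr => b _ do rewrite mulrC; rewrite sum_indicator.
rewrite !sum_indicator -[a - a']opprB qcharN (eq_sym a') (negPf Daa').
by rewrite subr0 mulr1 opprK subrK subrr.
Qed.

Lemma paley_hadamard : normalized_hadamard paley_matrix None.
Proof.
by split; [exact: paley_sqr|case|exact: paley_rows|apply/rows_to_cols/paley_rows].
Qed.

End QuadraticCharacter.

(** The Kronecker product with the Hadamard matrix of order 2. *)
Definition sylvester_matrix (S : Type) (H : S -> S -> int) (x y : S * bool) : int :=
  H x.1 y.1 * (if x.2 && y.2 then -1 else 1).

Lemma sylvester_double (S : finType) (H : S -> S -> int) c0 :
  normalized_hadamard H c0 ->
  normalized_hadamard (sylvester_matrix H) (c0, false).
Proof.
case=> sqr col0 rows cols.
have rows2 (x x' : S * bool) :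
    \sum_y sylvester_matrix H x y * sylvester_matrix H x' y =
      #|{: S * bool}|%:R *+ (x == x').
  rewrite -(pair_bigA _ (fun y e =>
    sylvester_matrix H x (y, e) * sylvester_matrix H x' (y, e))) /=.
  under eq_bigr => y _ do
    rewrite big_bool /sylvester_matrix /= !andbT !andbF /= mulrACA
      [X in _ + X]mulrACA -mulrDr.
  rewrite -mulr_suml rows card_prod card_bool natrM.
  case: x x' => [x e] [x' e'] /=; rewrite xpair_eqE.
  by case: (x == x'); case: e; case: e'; rewrite /= ?mul0r ?mulr0.
split=> // [x y|x|]; last exact: rows_to_cols.
  by rewrite /sylvester_matrix mulrACA sqr mul1r; case: ifP.
by rewrite /sylvester_matrix col0 andbF mul1r.
Qed.

Definition has_hadamard (s : nat) : Prop :=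
  exists (S : finType) (H : S -> S -> int) (c0 : S),
    #|S| = s /\ normalized_hadamard H c0.

Lemma has_hadamard_double s e : has_hadamard s -> has_hadamard (s * 2 ^ e).
Proof.
elim: e => [|e IHe] Hs; first by rewrite muln1.
have [S [H [c0 [cardS hadH]]]] := IHe Hs.
do 3!eexists; split; last exact: sylvester_double hadH.
by rewrite card_prod card_bool cardS expnSr mulnA.
Qed.

Lemma has_hadamard_paley p k :
  prime p -> (0 < k)%N -> (p ^ k %% 4 = 3)%N -> has_hadamard (p ^ k).+1.
Proof.
move=> p_pr k_gt0 mod4; have [F _ cardF] := pPrimePowerField p_pr k_gt0.
exists (option F), (@paley_matrix F), None.
by rewrite card_option cardF; split=> //; apply: paley_hadamard; rewrite cardF.
Qed.

(** * Linked systems from orthogonal arrays and Hadamard matrices *)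

Lemma sqr1_or (x : int) : x * x = 1 -> x = 1 \/ x = -1.
Proof.
move=> /eqP; rewrite -expr2 -(expr1n _ 2) eqf_sqr.
by case/orP=> /eqP ->; [left | right].
Qed.

Lemma card_setI_sum (V : finType) (A : {set V}) (P : pred V) :
  #|[set c in A | P c]|%:Z = \sum_(c in A) (P c)%:R.
Proof.
rewrite -natz -natr_sum -sum1_card; congr _%:R.
rewrite big_mkcond [RHS]big_mkcond; apply: eq_bigr => c _; rewrite inE.
by case: (c \in A); case: (P c).
Qed.

Lemma sign_count (V : finType) (A : {set V}) (f : V -> int) :
  (forall c, f c * f c = 1) ->
  #|[set c in A | f c == 1]|%:Z * 2 = #|A|%:Z + \sum_(c in A) f c.
Proof.
move=> f1; rewrite card_setI_sum -sum1_card -natz natr_sum -big_split mulr_suml.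
by apply: eq_bigr => c _; have [->|->] := sqr1_or (f1 c).
Qed.

(** The product [(1 + f c) * (1 + g c)] is 4 where both signs are 1, and 0
    elsewhere. *)
Lemma sign_count2 (V : finType) (A : {set V}) (f g : V -> int) :
  (forall c, f c * f c = 1) -> (forall c, g c * g c = 1) ->
  #|[set c in A | (f c == 1) && (g c == 1)]|%:Z * 4 =
    #|A|%:Z + \sum_(c in A) f c + \sum_(c in A) g c + \sum_(c in A) f c * g c.
Proof.
move=> f1 g1; rewrite card_setI_sum -sum1_card -natz natr_sum -!big_split mulr_suml.
apply: eq_bigr => c _.
by have [->|->] := sqr1_or (f1 c); have [->|->] := sqr1_or (g1 c).
Qed.

(** The coordinate [None] of the array is the discarded class, which numbers
    the points of the lines. A vertex [(i, (l, r))] stands for the vector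
    whose support is the line [l] of class [i] and whose entries are those of
    row [r] of [H]; the function [join] returns the point common to two lines
    of different classes. *)
Section LinkedSystem.

Variables (w : nat) (S : finType) (words : (option 'I_w -> S) -> Prop).
Variables (H : S -> S -> int) (c0 : S).
Variable (join : 'I_w -> 'I_w -> S -> S -> option 'I_w -> S).
Hypothesis OA : orthogonal_array words.
Hypothesis hadH : normalized_hadamard H c0.
Hypothesis joinP : forall i j l l', i != j ->
  [/\ words (join i j l l'), join i j l l' (Some i) = l
    & join i j l l' (Some j) = l'].

Local Notation s := #|S|.
Local Notation V := ('I_w * (S * S))%type.

Definition meet i j l l' : S := join i j l l' None.

Lemma meetE x i j : words x -> i != j ->
  meet i j (x (Some i)) (x (Some j)) = x None.
Proof.
move=> Wx Dij; have [Wj ji jj] := joinP (x (Some i)) (x (Some j)) Dij.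
apply: (OA.2 (Some i) (Some j)) => //.
by case=> /eqP; rewrite (negPf Dij).
Qed.

Lemma meetC i j l l' : i != j -> meet i j l l' = meet j i l' l.
Proof.
move=> Dij; have [Wj ji jj] := joinP l l' Dij.
by rewrite -{2}ji -{2}jj meetE // eq_sym.
Qed.

Lemma meet_inj i j l : i != j -> injective (meet i j l).
Proof.
move=> Dij m m' eqm.
have [Wj ji jj] := joinP l m Dij; have [Wj' ji' jj'] := joinP l m' Dij.
rewrite -jj -jj'; apply: (OA.2 (Some i) None) => //.
by rewrite ji ji'.
Qed.

(** If the line [m] of class [h] cuts two other lines at points with the same
    number, these points agree on the two coordinates [Some h] and [None], so
    they are one point, the intersection of the three lines. *)
Lemma meet_common i j h l l' m : i != h -> j != h -> i != j ->
  (meet i h l m == meet j h l' m) = (m == join i j l l' (Some h)).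
Proof.
move=> Dih Djh Dij; have [Wx xi xj] := joinP l l' Dij.
apply/eqP/eqP=> [eqm|->]; last first.
  by have := meetE Wx Dih; have := meetE Wx Djh; rewrite xi xj => -> ->.
have [Wy yi yh] := joinP l m Dih; have [Wy' yj' yh'] := joinP l' m Djh.
have eqy : join i h l m =1 join j h l' m.
  by apply: (OA.2 (Some h) None) => //; rewrite yh yh'.
rewrite -yh; apply: (OA.2 (Some i) (Some j)) => //; last by rewrite eqy yj' xj.
- by case=> /eqP; rewrite (negPf Dij).
- by rewrite yi xi.
Qed.

Lemma meet_join i j h l l' : i != h -> i != j ->
  meet i h l (join i j l l' (Some h)) = meet i j l l'.
Proof.
move=> Dih Dij; have [Wx xi _] := joinP l l' Dij.
by have := meetE Wx Dih; rewrite xi.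
Qed.

(** The inner product of two vectors from different classes, whose supports
    share only the point numbered [z]. *)
Definition gram (a b : V) : int :=
  let z := meet a.1 b.1 a.2.1 b.2.1 in H a.2.2 z * H b.2.2 z.

Lemma gram_sqr a b : gram a b * gram a b = 1.
Proof. by rewrite /gram mulrACA !(hadamard_sqr hadH) mul1r. Qed.

Lemma gramC a b : a.1 != b.1 -> gram a b = gram b a.
Proof. by move=> Dab; rewrite /gram meetC // mulrC. Qed.

Definition fiber (h : 'I_w) : {set V} := [set a | a.1 == h].

Lemma sum_fiber (h : 'I_w) (G : V -> int) :
  \sum_(c in fiber h) G c = \sum_m \sum_r G (h, (m, r)).
Proof.
rewrite pair_bigA /= (reindex (fun p : S * S => (h, p))) /=.
  by apply: eq_big => [p|p _]; [rewrite inE eqxx|case: p].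
exists snd => [p|[i p]]; rewrite !inE //=.
by move=> /eqP ->.
Qed.

Lemma card_fiber h : #|fiber h| = (s * s)%N.
Proof.
have -> : fiber h = [set (h, p) | p : S * S].
  apply/setP=> -[i p]; rewrite inE /=; apply/eqP/imsetP=> [->|[q _ [-> _]] //].
  by exists p.
by rewrite card_imset ?card_prod // => p q [].
Qed.

(** Summed over the rows [r] of [H], the columns [z] and [c0] are orthogonal
    unless they are equal, and exactly one line of class [h] cuts the line of
    [a] at the point numbered [c0]. *)
Lemma sum_gram a h : a.1 != h -> \sum_(c in fiber h) gram a c = s%:R.
Proof.
move=> Dah; rewrite sum_fiber /gram /=.
transitivity (\sum_m H a.2.2 (meet a.1 h a.2.1 m) *
    (s%:R *+ (meet a.1 h a.2.1 m == c0))).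
  apply: eq_bigr => m _; rewrite -mulr_sumr -(hadamard_cols hadH); congr (_ * _).
  by apply: eq_bigr => r _; rewrite (hadamard_col0 hadH) mulr1.
rewrite -(reindex_inj (meet_inj Dah) (P := xpredT)
  (F := fun z => H a.2.2 z * (s%:R *+ (z == c0)))) /=.
rewrite (bigD1 c0) //= eqxx mulr1n (hadamard_col0 hadH) mul1r big1 ?addr0 //.
by move=> z /negPf->; rewrite mulr0n mulr0.
Qed.

(** The columns of [H] being orthogonal, only the lines of class [h] that cut
    the lines of [a] and [b] at points with the same number contribute. For
    different classes this is one line, for distinct lines of one class there
    is none, and for equal lines all points are met once, which leaves the
    inner product of two rows of [H]. *)
Lemma sum_gram_gram a b h : a.1 != h -> b.1 != h ->
  \sum_(c in fiber h) gram a c * gram b c =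
    if a.1 == b.1 then (s * s)%:R *+ (a == b) else s%:R * gram a b.
Proof.
move=> Dah Dbh; rewrite sum_fiber.
transitivity (\sum_m H a.2.2 (meet a.1 h a.2.1 m) * H b.2.2 (meet b.1 h b.2.1 m)
    * (s%:R *+ (meet a.1 h a.2.1 m == meet b.1 h b.2.1 m))).
  apply: eq_bigr => m _; rewrite -(hadamard_cols hadH) mulr_sumr.
  by apply: eq_bigr => r _; rewrite /gram /= mulrACA.
case: ifPn => [/eqP eqi|Dij].
  case: a b eqi {Dbh} Dah => i [l r] [j [l' r']] /= <-{j} Dih.
  have [<-{l'}|Dl] := eqVneq l l'; last first.
    rewrite !xpair_eqE (negPf Dl) /= andbF mulr0n big1 // => m _.
    case: eqP => [eqm|_]; last by rewrite mulr0n mulr0.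
    case/eqP: Dl; apply: (@meet_inj h i m); first by rewrite eq_sym.
    by rewrite -!(meetC _ _ Dih).
  under eq_bigr => m _ do rewrite eqxx mulr1n.
  rewrite -mulr_suml -(reindex_inj (meet_inj Dih) (P := xpredT)
    (F := fun z => H r z * H r' z)) /= (hadamard_rows hadH) !xpair_eqE !eqxx /=.
  by rewrite natrM mulrnAl.
rewrite (bigD1 (join a.1 b.1 a.2.1 b.2.1 (Some h))) //= big1 => [|m /negPf Dm].
  rewrite meet_common // eqxx mulr1n addr0 mulrC; congr (_ * _).
  rewrite meet_join //; congr (_ * H _ _).
  rewrite -(meet_join _ _ Dah Dij).
  by apply/esym/eqP; rewrite meet_common.
by rewrite meet_common // Dm mulr0n mulr0.
Qed.

Definition linked_adj : rel V := fun a b => (a.1 != b.1) && (gram a b == 1).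

Lemma linked_adjC : symmetric linked_adj.
Proof.
move=> a b; rewrite /linked_adj eq_sym; have [//|Dab] := eqVneq b.1 a.1.
by rewrite gramC // eq_sym.
Qed.

Lemma card_linked_neighbours a h : a.1 != h ->
  #|[set c in fiber h | linked_adj a c]| = ((s * s + s) %/ 2)%N.
Proof.
move=> Dah; have -> : [set c in fiber h | linked_adj a c] =
    [set c in fiber h | gram a c == 1].
  by apply/setP=> c; rewrite !inE /linked_adj; case: eqP => //= ->; rewrite Dah.
have := sign_count (fiber h) (gram_sqr a).
by rewrite card_fiber sum_gram //; lia.
Qed.

Lemma card_linked_common a b h (e : int) : a.1 != h -> b.1 != h ->
  \sum_(c in fiber h) gram a c * gram b c = e ->
  #|[set c in fiber h | linked_adj a c && linked_adj b c]|%:Z * 4 =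
    (s * s + 2 * s)%N%:Z + e.
Proof.
move=> Dah Dbh <-.
have -> : [set c in fiber h | linked_adj a c && linked_adj b c] =
    [set c in fiber h | (gram a c == 1) && (gram b c == 1)].
  apply/setP=> c; rewrite !inE /linked_adj; case: eqP => //= ->.
  by rewrite Dah Dbh.
rewrite sign_count2; [|exact: gram_sqr|exact: gram_sqr].
by rewrite card_fiber !sum_gram //; lia.
Qed.

Definition fibers : {set {set V}} := fiber @: [set: 'I_w].

(** With [v = s ^ 2], row sums [s] and product sums [e], a row has [(v + s) /
    2] entries 1, and two rows have [(v + 2 s + e) / 4] common ones. In one
    fiber [e] is 0; in two fibers it is [s] for adjacent vertices and [- s]
    for the others. *)
Lemma linked_LSSD : (1 < w)%N ->
  is_LSSD linked_adj fibers (s * s) ((s * s + s) %/ 2) ((s * s + 2 * s) %/ 4) w.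
Proof.
move=> w_gt1.
have fiber_nonempty h : (h, (c0, c0)) \in fiber h by rewrite inE.
have fiber_inj : injective fiber.
  by move=> i j /setP/(_ (i, (c0, c0))); rewrite !inE eqxx => /esym/eqP.
have same_fiber a b h : a.1 != h -> b.1 != h -> a.1 = b.1 -> a != b ->
    #|[set c in fiber h | linked_adj a c && linked_adj b c]| =
      ((s * s + 2 * s) %/ 4)%N.
  move=> Dah Dbh eqab Dab.
  have := card_linked_common Dah Dbh (sum_gram_gram Dah Dbh).
  by rewrite eqab eqxx (negPf Dab) mulr0n addr0; lia.
split=> //.
- exact: linked_adjC.
- by move=> a; rewrite /linked_adj eqxx.
- by rewrite !card_prod card_ord.
- apply/and3P; split.
  + apply/eqP/setP=> a; rewrite inE; apply/bigcupP.
    by exists (fiber a.1); rewrite ?imset_f ?inE.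
  + apply/trivIsetP=> _ _ /imsetP[i _ ->] /imsetP[j _ ->].
    apply: contraR => /pred0Pn[a /=]; rewrite !inE => /andP[/eqP <- /eqP <-].
    by [].
  + by apply/imsetP=> -[i _ /setP/(_ (i, (c0, c0)))]; rewrite !inE eqxx.
- by rewrite card_imset // cardsT card_ord.
- by move=> _ /imsetP[i _ ->]; apply: card_fiber.
- move=> _ /imsetP[i _ ->] a b; rewrite !inE => /eqP ai /eqP bi.
  by rewrite /linked_adj ai bi eqxx.
- move=> _ _ /imsetP[i _ ->] /imsetP[j _ ->].
  rewrite (inj_eq fiber_inj) => Dij; have Dji : j != i by rewrite eq_sym.
  have neq_of (a : V) h h' : a \in fiber h -> h != h' -> a.1 != h'.
    by rewrite inE => /eqP ->.
  split; try exact: card_fiber.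
  + move=> b /neq_of /(_ Dji) Dbi; rewrite -(card_linked_neighbours Dbi).
    by apply: eq_card => a; rewrite !inE linked_adjC.
  + by move=> a /neq_of /(_ Dij); apply: card_linked_neighbours.
  + move=> a b fa fb Dab; apply: same_fiber => //; try exact: neq_of Dij.
    by move: fa fb; rewrite !inE => /eqP-> /eqP->.
  + move=> a b fa fb Dab.
    have {1}<- : #|[set c in fiber i | linked_adj a c && linked_adj b c]| =
      ((s * s + 2 * s) %/ 4)%N.
      apply: same_fiber => //; try exact: neq_of Dji.
      by move: fa fb; rewrite !inE => /eqP-> /eqP->.
    by apply: eq_card => c; rewrite !inE !(linked_adjC c).
exists ((s * s + 3 * s) %/ 4)%N, ((s * s + s) %/ 4)%N.
move=> _ _ _ /imsetP[h _ ->] /imsetP[i _ ->] /imsetP[j _ ->].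
rewrite !(inj_eq fiber_inj) => Dhi Dhj Dij a b; rewrite !inE => /eqP ai /eqP bj.
have Dah : a.1 != h by rewrite ai eq_sym.
have Dbh : b.1 != h by rewrite bj eq_sym.
have Dab : a.1 != b.1 by rewrite ai bj.
have := card_linked_common Dah Dbh (sum_gram_gram Dah Dbh).
rewrite (negPf Dab) /linked_adj Dab /=.
by have [->|->] := sqr1_or (gram_sqr a b); rewrite /= natz;
  move: #|[set _ | _]| #|S| => N x; lia.
Qed.

End LinkedSystem.

Lemma LSSD_of_OA_hadamard (w s : nat) :
  (1 < w)%N -> has_OA (option 'I_w) s -> has_hadamard s ->
  LSSD_exists (s * s) ((s * s + s) %/ 2) ((s * s + 2 * s) %/ 4) w.
Proof.
move=> w_gt1 OAs [S [H [c0 [cardS hadH]]]].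
have [words OA] := OA_on_card cardS OAs.
have [|join joinP] := @fin_all_exists ('I_w * 'I_w * (S * S))%type _
  (fun q x => q.1.1 != q.1.2 ->
    [/\ words x, x (Some q.1.1) = q.2.1 & x (Some q.1.2) = q.2.2]).
  move=> [[i j] [l l']] /=; have [->|Dij] := eqVneq i j.
    (* [join] is arbitrary on two lines of one class. *)
    by exists (fun=> l).
  have [|x Wx [xi xj]] := OA.1 (Some i) (Some j) _ l l'.
    by case=> /eqP; rewrite (negPf Dij).
  by exists x.
rewrite -cardS.
pose join' i j l l' := join ((i, j), (l, l')).
have join'P i j l l' : i != j ->
    [/\ words (join' i j l l'), join' i j l l' (Some i) = l
      & join' i j l l' (Some j) = l'] by exact: joinP ((i, j), (l, l')).
by do 3!eexists; apply: (linked_LSSD OA hadH join'P).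
Qed.

Local Close Scope ring_scope.

Theorem corollary8p8 (n w : nat) (hn : 1 <= n) (hw : 2 < w) :
  exists t : nat, 0 < t /\ odd t /\
    exists k lambda : nat,
      nondegenerate (16 ^ n * t) k /\ LSSD_exists (16 ^ n * t) k lambda w.
Proof.
(* The array needs [w + 1] coordinates: one for each fiber and the discarded
   class. *)
have [N has_OA_N] := @has_OA_large_even w.+2 isT.
pose q := 3 ^ N.*2.+1.
(* Modulo 8, so that [q.+1] is 4 times an odd number. *)
have q_mod8 : q %% 8 = 3.
  rewrite /q expnS -mul2n expnM -modnMmr -modnXm.
  by rewrite (_ : 3 ^ 2 %% 8 = 1) // exp1n.
have q_mod4 : q %% 4 = 3 by rewrite -(@modn_dvdm 8 q 4) // q_mod8.
pose r := q.+1 %/ 4; pose s := q.+1 * 2 ^ (n.-1).*2.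
have r_odd : odd r by rewrite /r; lia.
have qr : q.+1 = 4 * r by rewrite /r; lia.
have q_big : N < q.
  apply: leq_ltn_trans (ltn_expl _ (isT : 1 < 3)).
  by rewrite -addnn; apply: leqW; apply: leq_addr.
have s_ge : q < s by rewrite /s leq_pmulr // expn_gt0.
have s4 : 4 * r <= s by rewrite -qr.
have sr : s = 4 ^ n * r.
  by rewrite /s qr -mul2n expnM mulnAC -expnS prednK.
have ss : s * s = 16 ^ n * (r * r).
  by rewrite sr mulnACA -expnMn.
exists (r * r); split; first by rewrite muln_gt0; case: (r) r_odd.
split; first by rewrite oddM r_odd.
exists ((s * s + s) %/ 2), ((s * s + 2 * s) %/ 4); rewrite -ss.
split.
  have s_ge4 : 4 <= s by apply: leq_trans s4; move: (r) r_odd => x; lia.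
  have : 4 * s <= s * s by rewrite leq_mul2r s_ge4 orbT.
  rewrite /nondegenerate; move: s_ge4 {ss}; move: (s * s) => ss; lia.
apply: LSSD_of_OA_hadamard; first exact: ltnW.
  apply: has_OA_N; last by rewrite card_option card_ord.
    by rewrite /s oddM qr oddM.
  exact: ltnW (ltn_trans q_big s_ge).
apply: has_hadamard_double; exact: has_hadamard_paley.
Qed.
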